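(* Let $\kappa_1,\kappa_2>0$ and $\alpha\in(0,1)$. There exist constants $K_1,K_2>0$, depending only on $\kappa_1,\kappa_2,\alpha$, such that the following holds. Let $f_0\in C^0(\mathbb{R},\mathbb{R})$ satisfy, for all $y\in\mathbb{R}$, $$\frac{\kappa_2}{(1+|y|)^{\alpha}}\geqslant f_0(y)\geqslant\frac{\kappa_1}{(1+|y|)^{\alpha}},$$ and let $f$ be the solution of the viscous Burgers equation $\partial_t f-\partial_x^2 f+f\,\partial_x f=0$ on $\mathbb{R}$ with initial data $f_0$. Then for all $t\geqslant 0$, $$\frac{K_1}{(1+t)^{\frac{\alpha}{1+\alpha}}}\leqslant\|f(\cdot,t)\|_{L^\infty(\mathbb{R})}\leqslant\frac{K_2}{(1+t)^{\frac{\alpha}{1+\alpha}}}.$$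
   Context: The solution of the viscous Burgers equation with initial data $f_0$ is the one given by the Hopf-Cole formula: $f(\cdot,0)=f_0$ and, for $t>0$, $x\in\mathbb{R}$, $$f(x,t)=\frac{\int_{\mathbb{R}}\frac{x-y}{t}\exp\left(-\frac{(x-y)^2}{4t}-\frac12\int_0^y f_0(z)\,dz\right)dy}{\int_{\mathbb{R}}\exp\left(-\frac{(x-y)^2}{4t}-\frac12\int_0^y f_0(z)\,dz\right)dy}.$$ *)

(* Defs.v *)
From HB Require Import structures.
From mathcomp Require Import all_boot all_order all_algebra.
From mathcomp Require Import all_classical all_reals all_analysis.
Set Implicit Arguments.
Unset Strict Implicit.
Unset Printing Implicit Defensive.
Import Order.TTheory GRing.Theory Num.Theory.
Import numFieldNormedType.Exports.
Local Open Scope classical_set_scope.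
Local Open Scope ring_scope.

(* The oriented integral of g from 0 to y: an integral over the set `[0, y]
   alone would vanish for y < 0. *)
Definition int0 (R : realType) (g : R -> R) (y : R) : R :=
  if 0 <= y then \int[@lebesgue_measure R]_(z in `[0, y]) g z
  else - \int[@lebesgue_measure R]_(z in `[y, 0]) g z.

Definition hopf_cole_kernel (R : realType) (f0 : R -> R) (x t y : R) : R :=
  expR (- (x - y) ^+ 2 / (4 * t) - 2^-1 * int0 f0 y).

(* Only the values at t >= 0 are meaningful. *)
Definition burgers_solution (R : realType) (f0 : R -> R) (x t : R) : R :=
  if 0 < t then
    (\int[@lebesgue_measure R]_y ((x - y) / t * hopf_cole_kernel f0 x t y))
    / (\int[@lebesgue_measure R]_y hopf_cole_kernel f0 x t y)
  else f0 x.

Definition Linfty_norm (R : realType) (g : R -> R) : \bar R :=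
  Lnorm (@lebesgue_measure R) +oo%E (EFin \o g).

(* Main.v *)
Require Import Defs.
From HB Require Import structures.
From mathcomp Require Import all_boot all_order all_algebra.
From mathcomp Require Import all_classical all_reals all_analysis.
From mathcomp Require Import measurable_realfun ess_sup_inf ring lra.
Set Implicit Arguments.
Unset Strict Implicit.
Unset Printing Implicit Defensive.
Import Order.TTheory GRing.Theory Num.Theory.
Import numFieldNormedType.Exports.
Local Open Scope classical_set_scope.
Local Open Scope ring_scope.

(** Write F for the primitive of f0 vanishing at 0, w = exp (- F / 2), and let
    Z(x) be the integral of exp (- (x - y)^2 / (4 t)) w(y) over y: the
    denominator of the Hopf-Cole formula.  The value m = f(x, t) is the mean of
    (x - y) / t under the probability density proportional to that integrand.
    Both bounds come from comparing Z(x + h) with Z(x) in two ways.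

    Moving x tilts the Gaussian by an exponential, so Jensen's inequality gives
    Z(x + h) >= exp (- h m / 2 - h^2 / (4 t)) Z(x) for every real h
    ([cole_mass_jensen]).  Translating the integration variable instead moves h
    into F: if F(y) <= F(y + h) + c for all y, then
    Z(x + h) <= exp (c / 2) Z(x) ([cole_mass_growth]).  Together they bound m by
    increments of F, without differentiating Z or integrating by parts.

    Upper bound.  The choice h = - m t gives m^2 t <= 2 c, where c bounds the
    increments of F over length m t ([cole_velocity_sqr_le]).  The decay of f0
    bounds these by kappa2 m t and by a multiple of (m t)^(1 - alpha)
    ([int0_growth]), whence m^(1 + alpha) t^alpha and m are bounded
    ([decay_rate]).

    Lower bound.  Take |x| <= 1.  The tilt by h = 2 sqrt t controls the
    exponential moment of (y - x) / sqrt t, and the mean of x - y is t m, which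
    the upper bound controls; hence the mean of |y| is at most of order
    rho = (1 + t)^(1 / (1 + alpha)) ([cole_spread]).  On the scale rho, f0 is at
    least of order rho^(- alpha), so F increases by at least a multiple of
    h rho^(- alpha) over length h, and Z(x + h) is smaller than Z(x) by a factor
    1 - c h rho^(- alpha) ([cole_mass_decay]).  Letting h tend to 0 in the Jensen
    inequality gives m >= c rho^(- alpha) ([cole_velocity_lower]).  As this holds
    for all x in [-1, 1], it bounds the essential supremum. *)

(** * Tame potentials and the Hopf-Cole weight *)

(** The properties of the primitive of f0 on which the integral estimates rest: it
    is nondecreasing and k-Lipschitz.  Translates of such an F are again of this
    kind, although they do not vanish at 0. *)
Definition tame_potential {R : realType} (k : R) (F : R -> R) : Prop :=
  forall a b, a <= b -> 0 <= F b - F a <= k * (b - a).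

Definition cole_kernel {R : realType} (F : R -> R) (t x y : R) : R :=
  expR (- (x - y) ^+ 2 / (4 * t) - 2^-1 * F y).

Definition cole_mass {R : realType} (F : R -> R) (t x : R) : R :=
  \int[@lebesgue_measure R]_y cole_kernel F t x y.

(** The Hopf-Cole quotient: the mean of (x - y) / t under the density proportional
    to [cole_kernel F t x]. *)
Definition cole_velocity {R : realType} (F : R -> R) (t x : R) : R :=
  (\int[@lebesgue_measure R]_y ((x - y) / t * cole_kernel F t x y)) / cole_mass F t x.

Lemma tame_potential_norm {R : realType} (k : R) (F : R -> R) (a b : R) :
  tame_potential k F -> `|F b - F a| <= k * `|b - a|.
Proof.
move=> hF; wlog ab : a b / a <= b => [th|].
  have [|/ltW ba] := leP a b; first exact: th.
  by rewrite distrC (distrC b); exact: th.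
have /andP[F0 Fk] := hF _ _ ab.
by rewrite (ger0_norm F0) ger0_norm ?subr_ge0.
Qed.

Lemma tame_potential_shift {R : realType} (k : R) (F : R -> R) (h : R) :
  tame_potential k F -> tame_potential k (fun y => F (y + h)).
Proof.
move=> hF a b ab; have := hF (a + h) (b + h).
by rewrite lerD2r opprD addrACA subrr addr0; exact.
Qed.

Lemma tame_potential_continuous {R : realType} (k : R) (F : R -> R) :
  0 <= k -> tame_potential k F -> continuous F.
Proof.
move=> k0 hF x; apply/(@cvgrPdist_le _ R^o) => e e0; near=> y.
apply: (le_trans (tame_potential_norm _ _ hF)).
have : `|x - y| <= e / (k + 1).
  by near: y; apply: cvgr_dist_le; [exact: cvg_id|rewrite divr_gt0//; lra].
rewrite ler_pdivlMr; last by lra.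
by have := normr_ge0 (x - y); nra.
Unshelve. all: by end_near. Qed.

Lemma continuous_cole_kernel {R : realType} (k : R) (F : R -> R) (t x : R) :
  0 <= k -> tame_potential k F -> continuous (cole_kernel F t x).
Proof.
move=> k0 hF y; apply: (@continuous_comp _ _ _ (fun y => _) expR);
  last exact: continuous_expR.
apply: (@cvgB _ R^o).
  apply: (@cvgMl _ _ _ _ (fun y : R => - (x - y) ^+ 2)); apply: (@cvgN _ R^o).
  apply: (@continuous_comp _ _ _ (fun y => x - y) (fun z => z ^+ 2));
    last exact: sqr_continuous.
  by apply: (@cvgB _ R^o); [exact: cvg_cst|exact: cvg_id].
by apply: cvgMr; exact: (tame_potential_continuous k0 hF).
Qed.

Lemma cole_kernel_ge0 {R : realType} (F : R -> R) (t x y : R) :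
  0 <= cole_kernel F t x y.
Proof. exact: expR_ge0. Qed.

(** The arithmetic-geometric mean inequality; it lets half of the Gaussian exponent
    absorb the at most exponential growth of exp (- F / 2). *)
Lemma gaussian_absorbs_linear {R : realType} (c k t u : R) : 0 < c -> 0 < t ->
  k * `|u| <= u ^+ 2 / (c * t) + k ^+ 2 * (c * t) / 4.
Proof.
move=> c0 t0; rewrite -(real_normK (num_real u)); set v := `|u|.
have ct0 : 0 < c * t by rewrite mulr_gt0.
rewrite -subr_ge0.
have -> : v ^+ 2 / (c * t) + k ^+ 2 * (c * t) / 4 - k * v =
    (v / (c * t) - k / 2) ^+ 2 * (c * t).
  by field; rewrite !gt_eqF.
by rewrite mulr_ge0 ?sqr_ge0 ?ltW.
Qed.

(** The weight is dominated by a Gaussian of twice the variance. *)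
Lemma integrable_cole_kernel {R : realType} (k : R) (F : R -> R) (t x : R) :
  0 <= k -> 0 < t -> tame_potential k F ->
  (@lebesgue_measure R).-integrable setT (EFin \o cole_kernel F t x).
Proof.
move=> k0 t0 hF; have s0 : 2 * Num.sqrt t != 0.
  by rewrite mulf_neq0 ?pnatr_eq0// gt_eqF// sqrtr_gt0.
(* Variance 4 t, so that the Gaussian exponent is - (y - x)^2 / (8 t). *)
pose C := expR (k ^+ 2 * t / 2 - F x / 2) / normal_peak (2 * Num.sqrt t).
have p0 := normal_peak_gt0 s0.
apply: (@le_integrable _ _ R lebesgue_measure setT measurableT _
  (fun y => C%:E * (normal_pdf x (2 * Num.sqrt t) y)%:E)%E).
- apply/measurable_EFinP.
  apply: continuous_measurable_fun; exact: continuous_cole_kernel k0 hF.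
- move=> y _.
  rewrite [X in (_ <= `|X|)%E](_ : _ = (C * normal_pdf x (2 * Num.sqrt t) y)%:E)//.
  rewrite !abse_EFin lee_fin.
  rewrite !ger0_norm ?mulr_ge0 ?divr_ge0 ?expR_ge0 ?normal_pdf_ge0 ?invr_ge0 ?(ltW p0)//.
  rewrite (normal_pdfE _ s0) mulrA divfK ?gt_eqF// -expRD ler_expR.
  rewrite exprMn sqr_sqrtr ?(ltW t0)//.
  have := tame_potential_norm x y hF; rewrite ler_norml => /andP[Fy _].
  have := @gaussian_absorbs_linear R 8 (k / 2) t (y - x) ltac:(lra) t0.
  have -> : - (x - y) ^+ 2 / (4 * t) = - 2 * ((y - x) ^+ 2 / (8 * t)).
    by field; rewrite gt_eqF.
  have -> : - (y - x) ^+ 2 / (2 ^+ 2 * t *+ 2) = - ((y - x) ^+ 2 / (8 * t)).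
    by field; rewrite gt_eqF.
  lra.
- exact: (integrableZl measurableT C (integrable_normal_pdf _ _)).
Qed.

(** The weight dominates a multiple of a Gaussian of half the variance, whose
    integral is known. *)
Lemma cole_mass_gt0 {R : realType} (k : R) (F : R -> R) (t x : R) :
  0 <= k -> 0 < t -> tame_potential k F -> 0 < cole_mass F t x.
Proof.
move=> k0 t0 hF; have s0 : Num.sqrt t != 0 by rewrite gt_eqF// sqrtr_gt0.
have p0 := normal_peak_gt0 s0.
pose c := expR (- (k ^+ 2 * t / 4) - F x / 2) / normal_peak (Num.sqrt t).
have c0 : 0 < c by rewrite divr_gt0 ?expR_gt0.
have pdf1 : \int[@lebesgue_measure R]_y normal_pdf x (Num.sqrt t) y = 1.
  by rewrite /Rintegral integral_normal_pdf.
have ipdf := integrable_normal_pdf x (Num.sqrt t).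
apply: (lt_le_trans c0); rewrite -[leLHS]mulr1 -pdf1 -RintegralZl//.
apply: le_Rintegral => //.
- by apply: (integrableZl measurableT c ipdf).
- exact: (@integrable_cole_kernel _ k).
move=> y _; rewrite (normal_pdfE _ s0) mulrA divfK ?gt_eqF// -expRD ler_expR.
rewrite sqr_sqrtr ?(ltW t0)//.
have := tame_potential_norm x y hF; rewrite ler_norml => /andP[_ Fy].
have := @gaussian_absorbs_linear R 4 (k / 2) t (y - x) ltac:(lra) t0.
have -> : - (x - y) ^+ 2 / (4 * t) = - ((y - x) ^+ 2 / (4 * t)).
  by field; rewrite gt_eqF.
have -> : - (y - x) ^+ 2 / (t *+ 2) = - 2 * ((y - x) ^+ 2 / (4 * t)).
  by field; rewrite gt_eqF.
lra.
Qed.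

(** Completing the square: displacing the centre of the Gaussian multiplies it by an
    exponential of a linear function. *)
Lemma cole_kernel_tilt {R : realType} (F : R -> R) (t x h y : R) : 0 < t ->
  cole_kernel F t (x + h) y =
  cole_kernel F t x y * expR (- (h / 2) * ((x - y) / t) - h ^+ 2 / (4 * t)).
Proof.
move=> t0; rewrite /cole_kernel -expRD; congr expR.
by field; rewrite gt_eqF.
Qed.

Lemma norm_le_expR {R : realType} (u : R) : `|u| <= expR u + expR (- u).
Proof.
have := expR_ge1Dx u; have := expR_ge1Dx (- u).
have := expR_gt0 u; have := expR_gt0 (- u).
by case: (ger0P u) => _; lra.
Qed.

(** The linear factor is bounded by exponentials, which only displace the centre of
    the Gaussian; so the two weights centred at x + 2 and x - 2 dominate. *)
Lemma integrable_moment {R : realType} (k : R) (F : R -> R) (t x : R) :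
  0 <= k -> 0 < t -> tame_potential k F ->
  (@lebesgue_measure R).-integrable setT
    (EFin \o (fun y => (x - y) / t * cole_kernel F t x y)).
Proof.
move=> k0 t0 hF; pose E := expR (2 ^+ 2 / (4 * t)).
have ck := continuous_cole_kernel (t := t) (x := x) k0 hF.
apply: (@le_integrable _ _ R lebesgue_measure setT measurableT _
  (EFin \o (fun y => E * (cole_kernel F t (x + 2) y + cole_kernel F t (x - 2) y)))).
- apply/measurable_EFinP; apply: measurable_funM.
    apply: continuous_measurable_fun => y; apply: cvgMl.
    by apply: (@cvgB _ R^o); [exact: cvg_cst|exact: cvg_id].
  exact: continuous_measurable_fun.
- move=> y _; rewrite !abse_EFin lee_fin.
  rewrite normrM (ger0_norm (cole_kernel_ge0 _ _ _ _)) [leRHS]ger0_norm; last first.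
    by rewrite mulr_ge0 ?addr_ge0 ?cole_kernel_ge0 ?expR_ge0.
  rewrite !cole_kernel_tilt// -mulrDr mulrCA mulrC ler_wpM2l ?cole_kernel_ge0//.
  rewrite mulrDr -!expRD.
  set u := (x - y) / t; set e := 2 ^+ 2 / (4 * t).
  have -> : e + (- (2 / 2) * u - e) = - u by field.
  have -> : e + (- (- 2 / 2) * u - (-2) ^+ 2 / (4 * t)) = u by rewrite sqrrN -/e; field.
  by rewrite addrC norm_le_expR.
- under [X in _.-integrable _ X]eq_fun do rewrite /= EFinM EFinD.
  apply: integrableZl => //; apply: integrableD => //;
    exact: (integrable_cole_kernel _ k0 t0 hF).
Qed.

Lemma integrable_lincomb {R : realType} (f g : R -> R) (a b : R) :
  (@lebesgue_measure R).-integrable setT (EFin \o f) ->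
  (@lebesgue_measure R).-integrable setT (EFin \o g) ->
  (@lebesgue_measure R).-integrable setT (EFin \o (fun y => a * f y + b * g y)).
Proof.
move=> fi gi.
exact: (integrableD measurableT (integrableZl measurableT a fi)
                                (integrableZl measurableT b gi)).
Qed.

Lemma Rintegral_lincomb {R : realType} (f g : R -> R) (a b : R) :
  (@lebesgue_measure R).-integrable setT (EFin \o f) ->
  (@lebesgue_measure R).-integrable setT (EFin \o g) ->
  \int[@lebesgue_measure R]_y (a * f y + b * g y) =
  a * \int[@lebesgue_measure R]_y f y + b * \int[@lebesgue_measure R]_y g y.
Proof.
move=> fi gi; rewrite RintegralD//; last 2 first.
- exact: (integrableZl measurableT a fi).
- exact: (integrableZl measurableT b gi).
by rewrite !RintegralZl.
Qed.

Lemma Rintegral_translation {R : realType} (g : R -> R) (h : R) :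
  continuous g -> (forall y, 0 <= g y) ->
  \int[@lebesgue_measure R]_y g y = \int[@lebesgue_measure R]_y g (y + h).
Proof.
move=> cg g0; rewrite /Rintegral; congr fine.
have d1 (y : R) : is_derive y 1 (fun z : R => z + h) 1.
  by rewrite -[X in is_derive _ _ _ X]addr0; exact: is_deriveD.
have D1 : derive1 (fun z : R => z + h) = cst 1.
  by apply/funext => y; rewrite derive1E; exact: derive_val.
rewrite (@increasing_ge0_integration_by_substitutionT _ (fun y => y + h))//.
- by apply: eq_integral => y _; rewrite D1 /= !fctE/= mulr1.
- by move=> a b; rewrite ltrD2r.
- by rewrite D1; exact: cst_continuous.
- by rewrite D1; exact: is_cvg_cst.
- by rewrite D1; exact: is_cvg_cst.
- exact: cvg_addrr_Ny.
- exact: cvg_addrr.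
Qed.

(** * Displacing the centre: tilt against translation *)

Lemma cole_mass_translation {R : realType} (k : R) (F : R -> R) (t x h : R) :
  0 <= k -> tame_potential k F ->
  cole_mass F t (x + h) = cole_mass (fun y => F (y + h)) t x.
Proof.
move=> k0 hF; rewrite /cole_mass (@Rintegral_translation _ _ h).
- by apply: eq_Rintegral => y _; rewrite /cole_kernel opprD addrACA subrr addr0.
- exact: continuous_cole_kernel k0 hF.
- by move=> y; exact: cole_kernel_ge0.
Qed.

(** After a translation the Gaussian factors agree, and the potentials are compared
    pointwise. *)
Lemma cole_mass_growth {R : realType} (k : R) (F : R -> R) (t x h w : R) :
  0 <= k -> 0 < t -> tame_potential k F ->
  (forall y, F y <= F (y + h) + w) ->
  cole_mass F t (x + h) <= expR (w / 2) * cole_mass F t x.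
Proof.
move=> k0 t0 hF hw; rewrite (cole_mass_translation _ _ _ k0 hF).
have iF := integrable_cole_kernel x k0 t0 hF.
rewrite -RintegralZl//; apply: le_Rintegral => //.
- exact: integrable_cole_kernel k0 t0 (tame_potential_shift _ hF).
- exact: (integrableZl measurableT _ iF).
- by move=> y _; rewrite /cole_kernel -expRD ler_expR; have := hw y; lra.
Qed.

Lemma cole_moment {R : realType} (k : R) (F : R -> R) (t x : R) :
  0 <= k -> 0 < t -> tame_potential k F ->
  \int[@lebesgue_measure R]_y ((x - y) / t * cole_kernel F t x y) =
  cole_velocity F t x * cole_mass F t x.
Proof.
by move=> k0 t0 hF; rewrite divfK// gt_eqF// (cole_mass_gt0 _ k0).
Qed.

(** Jensen's inequality for the tilt by h: the tangent line to the exponential at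
    the mean exponent - h m / 2 - h^2 / (4 t) integrates exactly, since its linear
    part has mean 0. *)
Lemma cole_mass_jensen {R : realType} (k : R) (F : R -> R) (t x h : R) :
  0 <= k -> 0 < t -> tame_potential k F ->
  expR (- (h / 2) * cole_velocity F t x - h ^+ 2 / (4 * t)) * cole_mass F t x
  <= cole_mass F t (x + h).
Proof.
move=> k0 t0 hF; set m := cole_velocity F t x; set e := expR _.
have iF := integrable_cole_kernel x k0 t0 hF.
have iM := integrable_moment x k0 t0 hF.
have -> : e * cole_mass F t x = \int[@lebesgue_measure R]_y
    (e * (1 + h / 2 * m) * cole_kernel F t x y
     + - (e * (h / 2)) * ((x - y) / t * cole_kernel F t x y)).
  rewrite Rintegral_lincomb// -/(cole_mass F t x) (cole_moment _ k0)// -/m.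
  by ring.
apply: le_Rintegral => //.
- exact: integrable_lincomb.
- exact: integrable_cole_kernel k0 t0 hF.
move=> y _; rewrite cole_kernel_tilt//; set u := (x - y) / t.
(* Split the tilt into its mean and a centred part. *)
have -> : - (h / 2) * u - h ^+ 2 / (4 * t) =
  (- (h / 2) * m - h ^+ 2 / (4 * t)) + h / 2 * (m - u) by ring.
rewrite expRD -/e.
have -> : e * (1 + h / 2 * m) * cole_kernel F t x y +
    - (e * (h / 2)) * (u * cole_kernel F t x y) =
  cole_kernel F t x y * (e * (1 + h / 2 * (m - u))) by ring.
apply: ler_wpM2l; first exact: cole_kernel_ge0.
by apply: ler_wpM2l; [exact: expR_ge0 | exact: expR_ge1Dx].
Qed.

Lemma tame_potential_nondecreasing {R : realType} (k : R) (F : R -> R) (y h : R) :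
  tame_potential k F -> 0 <= h -> F y <= F (y + h).
Proof.
move=> hF h0; have /andP[+ _] := hF y (y + h) ltac:(by rewrite lerDl).
by rewrite subr_ge0.
Qed.

(** The upper and lower bounds for Z(x + h) / Z(x), compared after taking
    logarithms. *)
Lemma cole_velocity_growth {R : realType} (k : R) (F : R -> R) (t x h w : R) :
  0 <= k -> 0 < t -> tame_potential k F ->
  (forall y, F y <= F (y + h) + w) ->
  - (h * cole_velocity F t x) - h ^+ 2 / (2 * t) <= w.
Proof.
move=> k0 t0 hF hw; have Z0 := cole_mass_gt0 x k0 t0 hF.
have := le_trans (cole_mass_jensen x h k0 t0 hF) (cole_mass_growth x k0 t0 hF hw).
rewrite ler_pM2r// ler_expR.
have -> : h ^+ 2 / (4 * t) = h ^+ 2 / (2 * t) / 2 by field; rewrite gt_eqF.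
by set q := _ / (2 * t); lra.
Qed.

(** Replaces passing to the limit h -> 0+. *)
Lemma le_of_small_error {R : realType} (A B C h0 : R) : 0 < h0 -> 0 <= C ->
  (forall h, 0 < h <= h0 -> A <= B + h * C) -> A <= B.
Proof.
move=> h00 C0 H; apply/ler_addgt0Pr => e e0.
pose h := Num.min h0 (e / (C + 1)).
have hh : 0 < h <= h0.
  by rewrite /h lt_min h00 ge_min lexx /= andbT divr_gt0 // ltr_wpDl.
apply: (le_trans (H h hh)); rewrite lerD2l.
have : h <= e / (C + 1) by rewrite /h ge_min lexx orbT.
rewrite ler_pdivlMr; last by lra.
by move=> ?; case/andP: hh => ? ?; nra.
Qed.

Lemma cole_velocity_ge0 {R : realType} (k : R) (F : R -> R) (t x : R) :
  0 <= k -> 0 < t -> tame_potential k F -> 0 <= cole_velocity F t x.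
Proof.
move=> k0 t0 hF; apply: (@le_of_small_error _ _ _ (2 * t)^-1 1) => //.
  by rewrite invr_ge0; lra.
move=> h /andP[h0 _].
have : - (h * cole_velocity F t x) - h ^+ 2 / (2 * t) <= 0.
  apply: (cole_velocity_growth x k0 t0 hF) => y; rewrite addr0.
  exact: tame_potential_nondecreasing hF (ltW h0).
have -> : - (h * cole_velocity F t x) - h ^+ 2 / (2 * t) =
  - (h * (cole_velocity F t x + h * (2 * t)^-1)) by field; rewrite gt_eqF.
by rewrite oppr_le0 pmulr_rge0.
Qed.

(** The displacement h = - m t maximises - h m - h^2 / (2 t). *)
Lemma cole_velocity_sqr_le {R : realType} (k : R) (F : R -> R) (t x w : R) :
  0 <= k -> 0 < t -> tame_potential k F ->
  (forall y, F y - F (y - cole_velocity F t x * t) <= w) ->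
  cole_velocity F t x ^+ 2 * t <= 2 * w.
Proof.
move=> k0 t0 hF; set m := cole_velocity F t x => hw.
have := cole_velocity_growth x k0 t0 hF
  (h := - (m * t)) (w := w) ltac:(move=> y; have := hw y; lra).
have -> : - (- (m * t) * cole_velocity F t x) - (- (m * t)) ^+ 2 / (2 * t) =
   m ^+ 2 * t / 2 by rewrite -/m; field; rewrite gt_eqF.
lra.
Qed.

(** * Spread of the weight and the lower bound *)

(** Write |x - y| = (x - y) + 2 (y - x)^+.  The mean of the first term is t m.  For
    the second, (y - x)^+ <= r exp ((y - x) / r) with r = sqrt t, and this
    exponential is the tilt by h = 2 r, whose total mass is at most e times that
    of the original weight, because Z is nonincreasing. *)
Lemma cole_spread {R : realType} (k : R) (F : R -> R) (t x : R) :
  0 <= k -> 0 < t -> tame_potential k F ->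
  (@lebesgue_measure R).-integrable setT
    (EFin \o (fun y => `|y| * cole_kernel F t x y)) /\
  \int[@lebesgue_measure R]_y (`|y| * cole_kernel F t x y) <=
  (`|x| + t * cole_velocity F t x + 2 * expR 1 * Num.sqrt t) * cole_mass F t x.
Proof.
move=> k0 t0 hF; set m := cole_velocity F t x; set r := Num.sqrt t.
have r0 : 0 < r by rewrite sqrtr_gt0.
have rr : t = r ^+ 2 by rewrite sqr_sqrtr// ltW.
have iF := integrable_cole_kernel x k0 t0 hF.
have iF2 := integrable_cole_kernel (x + 2 * r) k0 t0 hF.
have iM := integrable_moment x k0 t0 hF.
pose b1 y := `|x| * cole_kernel F t x y + t * ((x - y) / t * cole_kernel F t x y).
pose b y := 1 * b1 y + 2 * expR 1 * r * cole_kernel F t (x + 2 * r) y.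
have ib1 : (@lebesgue_measure R).-integrable setT (EFin \o b1).
  exact: integrable_lincomb.
have ib : (@lebesgue_measure R).-integrable setT (EFin \o b).
  exact: integrable_lincomb.
have yb y : `|y| * cole_kernel F t x y <= b y.
  rewrite /b /b1 mul1r cole_kernel_tilt//; set u := (x - y) / r.
  have -> : - (2 * r / 2) * ((x - y) / t) - (2 * r) ^+ 2 / (4 * t) = - u - 1.
    by rewrite rr /u; field; rewrite gt_eqF.
  rewrite expRD expRN.
  have -> : `|x| * cole_kernel F t x y + t * ((x - y) / t * cole_kernel F t x y)
      + 2 * expR 1 * r * (cole_kernel F t x y * ((expR u)^-1 * expR (-1))) =
      (`|x| + (x - y) + 2 * r * expR (- u)) * cole_kernel F t x y.
    rewrite !expRN; field; rewrite !gt_eqF ?expR_gt0//.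
  rewrite ler_wpM2r ?cole_kernel_ge0//.
  have xy : x - y = r * u by rewrite /u; field; rewrite gt_eqF.
  have yE : `|y| <= `|x| + `|x - y|.
    by rewrite -[y in `|y|](subKr x) ler_normB.
  have e1 := expR_ge1Dx (- u); have e0 := expR_gt0 (- u).
  apply: (le_trans yE); rewrite -addrA lerD2l xy normrM gtr0_norm// [2 * r]mulrC.
  rewrite -mulrA -mulrDr ler_pM2l//.
  by case: (ger0P u) => _; lra.
have iy : (@lebesgue_measure R).-integrable setT
    (EFin \o (fun y => `|y| * cole_kernel F t x y)).
  apply: (@le_integrable _ _ R lebesgue_measure setT measurableT _ _ _ _ ib).
  - apply/measurable_EFinP; apply: measurable_funM; first exact: normr_measurable.
    apply: continuous_measurable_fun; exact: continuous_cole_kernel k0 hF.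
  - move=> y _; rewrite !abse_EFin lee_fin ger0_norm ?mulr_ge0 ?cole_kernel_ge0//.
    exact: le_trans (yb y) (ler_norm _).
split=> //; apply: (@le_trans _ _ (\int[@lebesgue_measure R]_y b y)).
  by apply: le_Rintegral => // y _; exact: yb.
rewrite /b Rintegral_lincomb// /b1 Rintegral_lincomb// (cole_moment _ k0)// -/m.
rewrite mul1r -/(cole_mass F t x) -/(cole_mass F t (x + 2 * r)).
have Zle : cole_mass F t (x + 2 * r) <= cole_mass F t x.
  have -> : cole_mass F t x = expR (0 / 2) * cole_mass F t x.
    by rewrite mul0r expR0 mul1r.
  apply: (cole_mass_growth x k0 t0 hF) => y; rewrite addr0.
  by apply: tame_potential_nondecreasing hF _; rewrite mulr_ge0 // ltW.
have c0 : 0 <= 2 * expR 1 * r by rewrite !mulr_ge0 ?expR_ge0// ltW.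
have -> : (`|x| + t * m + 2 * expR 1 * r) * cole_mass F t x =
  `|x| * cole_mass F t x + t * (m * cole_mass F t x) +
  2 * expR 1 * r * cole_mass F t x by ring.
by rewrite lerD2l ler_wpM2l.
Qed.

Lemma expRN_le {R : realType} (u : R) : 0 <= u <= 1 -> expR (- u) <= 1 - u / 2.
Proof.
move=> /andP[u0 u1]; rewrite expRN.
have e0 := expR_gt0 u; have e1 := expR_ge1Dx u.
by rewrite -[leLHS]mul1r ler_pdivrMr//; nra.
Qed.

(** The density places enough mass on |y| <= a for the increments of F there to be
    felt: the spread hypothesis makes the mean of |y| at most a / 2.  The affine
    function 1 - (u / 2) (1 - |y| / a) bounds exp (- (F (y + h) - F y) / 2) for all
    y, by [expRN_le] if |y| <= a and because it is at least 1 otherwise, and its mean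
    is at most 1 - u / 4. *)
Lemma cole_mass_decay {R : realType} (k : R) (F : R -> R) (t x h a u : R) :
  0 <= k -> 0 < t -> tame_potential k F -> 0 <= h -> 0 < a -> 0 <= u <= 1 ->
  `|x| + t * cole_velocity F t x + 2 * expR 1 * Num.sqrt t <= a / 2 ->
  (forall y, `|y| <= a -> 2 * u <= F (y + h) - F y) ->
  cole_mass F t (x + h) <= (1 - u / 4) * cole_mass F t x.
Proof.
move=> k0 t0 hF h0 a0 /andP[u0 u1] ha hu; rewrite (cole_mass_translation _ _ _ k0 hF).
have Z0 := cole_mass_gt0 x k0 t0 hF.
have [iS leS] := cole_spread x k0 t0 hF.
have iF := integrable_cole_kernel x k0 t0 hF.
apply: (@le_trans _ _ (\int[@lebesgue_measure R]_y
   ((1 - u / 2) * cole_kernel F t x y + u / (2 * a) * (`|y| * cole_kernel F t x y)))).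
  apply: le_Rintegral => //.
  - exact: integrable_cole_kernel k0 t0 (tame_potential_shift _ hF).
  - exact: integrable_lincomb.
  move=> y _.
  have -> : cole_kernel (fun y => F (y + h)) t x y =
    expR (- ((F (y + h) - F y) / 2)) * cole_kernel F t x y.
    by rewrite /cole_kernel -expRD; congr expR; field; rewrite gt_eqF.
  rewrite mulrA -mulrDl ler_wpM2r ?cole_kernel_ge0//.
  have y0 : 0 <= u / (2 * a) * `|y| by rewrite mulr_ge0 ?divr_ge0//; lra.
  have [ya|ay] := leP `|y| a.
    apply: (@le_trans _ _ (expR (- u))).
      by rewrite ler_expR; have := hu y ya; lra.
    by have := @expRN_le _ u; rewrite u0 u1 => /(_ isT); lra.
  apply: (@le_trans _ _ 1).
    rewrite expR_le1 oppr_le0 divr_ge0// subr_ge0.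
    exact: tame_potential_nondecreasing hF h0.
  have : u / 2 <= u / (2 * a) * `|y|.
    have -> : u / (2 * a) * `|y| = u / 2 * (`|y| / a) by field; rewrite gt_eqF.
    by rewrite ler_peMr ?divr_ge0// ler_pdivlMr// mul1r ltW.
  by lra.
rewrite Rintegral_lincomb// -/(cole_mass F t x).
have : u / (2 * a) * \int[@lebesgue_measure R]_y (`|y| * cole_kernel F t x y)
    <= u / 4 * cole_mass F t x.
  have -> : u / 4 * cole_mass F t x = u / (2 * a) * (a / 2 * cole_mass F t x).
    by field; rewrite gt_eqF.
  apply: ler_wpM2l; first by rewrite divr_ge0//; lra.
  by apply: (le_trans leS); rewrite ler_pM2r.
by lra.
Qed.

(** To first order in h, Z decreases by h m / 2 in relative terms according to the
    Jensen bound, and by at least h v / 4 according to [cole_mass_decay]. *)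
Lemma cole_velocity_lower {R : realType} (k : R) (F : R -> R) (t x a v h0 : R) :
  0 <= k -> 0 < t -> tame_potential k F -> 0 < a -> 0 < v -> 0 < h0 ->
  `|x| + t * cole_velocity F t x + 2 * expR 1 * Num.sqrt t <= a / 2 ->
  (forall h y, 0 < h <= h0 -> `|y| <= a -> 2 * (h * v) <= F (y + h) - F y) ->
  v / 2 <= cole_velocity F t x.
Proof.
move=> k0 t0 hF a0 v0 h00 ha hv.
apply: (@le_of_small_error _ _ _ (2 * t)^-1 (Num.min h0 v^-1)).
- by rewrite lt_min h00 invr_gt0.
- by rewrite invr_ge0; lra.
move=> h /andP[h_gt0]; rewrite le_min => /andP[hh0 hv1].
have u01 : 0 <= h * v <= 1.
  by rewrite mulr_ge0 ?(ltW h_gt0) ?(ltW v0)//= -ler_pdivlMr// mul1r.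
have := cole_mass_decay k0 t0 hF (ltW h_gt0) a0 u01 ha.
have hvy y : `|y| <= a -> 2 * (h * v) <= F (y + h) - F y.
  by apply: hv; rewrite h_gt0.
move=> /(_ hvy) /(le_trans (cole_mass_jensen x h k0 t0 hF)).
rewrite ler_pM2r ?(cole_mass_gt0 x k0 t0 hF)// => /(le_trans (expR_ge1Dx _)).
set m := cole_velocity F t x => H.
rewrite -(ler_pM2l h_gt0).
have -> : h * (m + h * (2 * t)^-1) = 2 * (h / 2 * m + h ^+ 2 / (4 * t)).
  by field; rewrite gt_eqF.
by move: H; set q := _ / (4 * t); lra.
Qed.

(** * Increments of the primitive of a decaying function *)

Lemma integrable_itvcc {R : realType} (g : R -> R) (a b : R) : continuous g ->
  (@lebesgue_measure R).-integrable `[a, b] (EFin \o g).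
Proof.
move=> cg; apply: continuous_compact_integrable; first exact: segment_compact.
exact: continuous_subspaceT.
Qed.

Lemma Rintegral_itv_chasles {R : realType} (g : R -> R) (a c b : R) :
  continuous g -> a <= c -> c <= b ->
  \int[@lebesgue_measure R]_(z in `[a, b]) g z =
  \int[@lebesgue_measure R]_(z in `[a, c]) g z +
  \int[@lebesgue_measure R]_(z in `[c, b]) g z.
Proof.
move=> cg ac cb.
have := @Rintegral_itvB R g (BLeft a) (BRight b) c (integrable_itvcc a b cg).
rewrite !bnd_simp => /(_ ac cb).
rewrite Rintegral_itv_obnd_cbnd; first by lra.
apply: integrableS (integrable_itvcc c b cg) => //.
exact: subset_itv_oc_cc.
Qed.

Lemma int0_sub {R : realType} (g : R -> R) (a b : R) : continuous g -> a <= b ->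
  int0 g b - int0 g a = \int[@lebesgue_measure R]_(z in `[a, b]) g z.
Proof.
move=> cg ab; rewrite /int0.
have [a0|a0] := leP 0 a.
  by rewrite (le_trans a0 ab) (Rintegral_itv_chasles cg a0 ab); lra.
have [b0|b0] := leP 0 b.
  by rewrite (Rintegral_itv_chasles cg (ltW a0) b0); lra.
by rewrite (Rintegral_itv_chasles cg ab (ltW b0)); lra.
Qed.

Lemma Rintegral_itv_cst {R : realType} (c a b : R) : a <= b ->
  \int[@lebesgue_measure R]_(z in `[a, b]) c = c * (b - a).
Proof.
move=> ab; rewrite Rintegral_cst// /= lebesgue_measure_itv/= lte_fin.
case: ltP => // ba; have -> : b = a by apply/eqP; rewrite eq_le ab ba.
by rewrite subrr mulr0.
Qed.

Lemma int0_bounds {R : realType} (g : R -> R) (l u a b : R) :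
  continuous g -> a <= b -> (forall y, a <= y <= b -> l <= g y <= u) ->
  l * (b - a) <= int0 g b - int0 g a <= u * (b - a).
Proof.
move=> cg ab H; rewrite int0_sub// -!(Rintegral_itv_cst _ ab).
by apply/andP; split; apply: le_Rintegral => //;
  (try exact: integrable_itvcc cg);
  (try by apply: integrable_itvcc; exact: cst_continuous) => y /=;
  rewrite in_itv/= => /H /andP[].
Qed.

(** For p <= 1 a share s in [0, 1] satisfies s <= s^p; apply this to x / (x + y) and
    y / (x + y). *)
Lemma powRD_le {R : realType} (p x y : R) : 0 < p <= 1 -> 0 <= x -> 0 <= y ->
  (x + y) `^ p <= x `^ p + y `^ p.
Proof.
move=> /andP[p0 p1] x0 y0.
have [->|xy0] := eqVneq (x + y) 0.
  by rewrite powR0 ?gt_eqF// addr_ge0 ?powR_ge0.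
have s0 : 0 < x + y by rewrite lt0r xy0 addr_ge0.
have S0 := powR_gt0 p s0.
have share z : 0 <= z -> z <= x + y -> z / (x + y) * (x + y) `^ p <= z `^ p.
  move=> z0 zs; have [->|zn0] := eqVneq z 0; first by rewrite !mul0r powR_ge0.
  have zgt0 : 0 < z by rewrite lt0r zn0.
  have {2}-> : z = z / (x + y) * (x + y) by rewrite divfK.
  rewrite powRM ?divr_ge0 ?(ltW s0)// ler_pM2r//.
  by apply: ger1_powR => //; rewrite divr_gt0//= ler_pdivrMr// mul1r.
have -> : (x + y) `^ p = x / (x + y) * (x + y) `^ p + y / (x + y) * (x + y) `^ p.
  by rewrite -mulrDl -mulrDl divff// mul1r.
by apply: lerD; apply: share => //; rewrite ?lerDl ?lerDr.
Qed.

(** On the half-line, (1 + z)^(1 - al) / (1 - al) is an explicit primitive of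
    (1 + z)^(- al), and its increments are controlled by subadditivity of the power
    1 - al. *)
Lemma Rintegral_decay_pos {R : realType} (al ka : R) (g : R -> R) (a b : R) :
  0 < al < 1 -> continuous g ->
  (forall y : R, 0 <= y -> g y <= ka / (1 + y) `^ al) -> 0 <= ka ->
  0 <= a -> a <= b ->
  \int[@lebesgue_measure R]_(z in `[a, b]) g z
  <= ka / (1 - al) * (b - a) `^ (1 - al).
Proof.
move=> /andP[al0 al1] cg hg ka0 a0.
have p0 : 0 < 1 - al by rewrite subr_gt0.
rewrite le_eqVlt => /predU1P[<-|ab].
  by rewrite set_itv1 Rintegral_set1 mulr_ge0 ?powR_ge0// divr_ge0 ?(ltW p0).
pose H (z : R) := ka / (1 - al) * (z + 1) `^ (1 - al).
pose q (z : R) := ka / (1 + z) `^ al.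
have dH (z : R) : 0 <= z -> is_derive z 1 H (q z).
  move=> z0; have z1 : 0 < z + 1 by rewrite ltr_wpDl.
  have d1 : is_derive z 1 (fun w : R => w + 1) 1.
    by rewrite -[X in is_derive _ _ _ X]addr0; exact: is_deriveD.
  have d2 := @is_derive1_powR R (1 - al) (z + 1) z1.
  have d3 : is_derive z 1 (fun w : R => (w + 1) `^ (1 - al)) _ :=
    @is_derive1_comp R (fun w : R => w `^ (1 - al)) (fun w => w + 1) z _ _ d2 d1.
  have d4 := is_deriveZ (ka / (1 - al)) d3.
  apply: is_derive_eq d4 _.
  rewrite /q [1 + z]addrC; set w := z + 1.
  have -> : 1 - al - 1 = - al by ring.
  rewrite powRN /GRing.scale/=; field.
  by rewrite !gt_eqF// powR_gt0.
have cH (z : R) : 0 <= z -> {for z, continuous H}.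
  by move=> z0; have [dz _] := dH z z0; exact/differentiable_continuous/derivable1_diffP.
have cq : {within `[a, b], continuous q}.
  apply: continuous_in_subspaceT => z /[!inE]/=; rewrite in_itv/= => /andP[az _].
  have z1 : 0 < 1 + z by rewrite ltr_pwDl// (le_trans a0).
  apply: cvgMr; apply: cvgV; first by rewrite gt_eqF// powR_gt0.
  have [dz _] := @is_derive1_powR R al (1 + z) z1.
  apply: (@continuous_comp _ _ _ (fun z : R => 1 + z) (fun w : R => w `^ al)).
    by apply: (@cvgD _ R^o); [exact: cvg_cst|exact: cvg_id].
  exact/differentiable_continuous/derivable1_diffP.
have ftc : \int[@lebesgue_measure R]_(z in `[a, b]) q z = H b - H a.
  rewrite /Rintegral (continuous_FTC2 ab cq (F := H))//.
    split.
    - move=> z; rewrite in_itv/= => /andP[az _].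
      by have [] := dH z (le_trans a0 (ltW az)).
    - by apply: cvg_at_right_filter; exact: cH.
    - by apply: cvg_at_left_filter; apply: cH; rewrite (le_trans a0 (ltW ab)).
  move=> z; rewrite in_itv/= => /andP[az _].
  by rewrite derive1E; have [_ ->] := dH z (le_trans a0 (ltW az)).
apply: (@le_trans _ _ (H b - H a)).
  rewrite -ftc; apply: le_Rintegral => //.
  - exact: integrable_itvcc.
  - by apply: continuous_compact_integrable => //; exact: segment_compact.
  - by move=> z /=; rewrite in_itv/= => /andP[az _]; apply: hg; rewrite (le_trans a0).
rewrite /H -mulrBr; apply: ler_wpM2l; first by rewrite divr_ge0// ltW.
rewrite lerBlDl.
have -> : b + 1 = (a + 1) + (b - a) by ring.
apply: powRD_le; rewrite ?subr_ge0 ?(ltW ab)//; last by rewrite addr_ge0.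
by rewrite p0 gerBl ltW.
Qed.

Lemma Rintegral_itv_oppr {R : realType} (g : R -> R) (a b : R) :
  continuous g -> a <= b ->
  \int[@lebesgue_measure R]_(z in `[a, b]) g z =
  \int[@lebesgue_measure R]_(z in `[- b, - a]) g (- z).
Proof.
move=> cg ab; rewrite /Rintegral; congr fine.
have := @integration_by_substitution_oppr R g (- b) (- a).
by rewrite !opprK lerN2 => ->//; exact: continuous_subspaceT.
Qed.

(** On an interval not containing 0 in its interior this is [Rintegral_decay_pos], up
    to reflection; otherwise each of the two halves contributes one such bound,
    hence the factor 2. *)
Lemma int0_growth {R : realType} (al ka : R) (g : R -> R) (a b : R) :
  0 < al < 1 -> continuous g -> 0 <= ka ->
  (forall y, g y <= ka / (1 + `|y|) `^ al) -> a <= b ->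
  int0 g b - int0 g a <= 2 * (ka / (1 - al)) * (b - a) `^ (1 - al).
Proof.
move=> al01 cg ka0 hg ab; rewrite int0_sub//.
set p := 1 - al; set C := ka / p; have /andP[al0 al1] := al01.
have p0 : 0 < p by rewrite subr_gt0.
have C0 : 0 <= C by rewrite divr_ge0 ?(ltW p0).
have pos c d : 0 <= c -> c <= d ->
    \int[@lebesgue_measure R]_(z in `[c, d]) g z <= C * (d - c) `^ p.
  by apply: Rintegral_decay_pos => // y y0; have := hg y; rewrite ger0_norm.
have neg c d : d <= 0 -> c <= d ->
    \int[@lebesgue_measure R]_(z in `[c, d]) g z <= C * (d - c) `^ p.
  move=> d0 cd; rewrite (Rintegral_itv_oppr cg cd).
  have -> : d - c = - c - - d by ring.
  apply: (@Rintegral_decay_pos _ al ka (fun z => g (- z))) => //.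
  - move=> z; apply: (@continuous_comp _ _ _ (fun z : R => - z) g); last exact: cg.
    exact: opp_continuous.
  - by move=> y y0; have := hg (- y); rewrite normrN ger0_norm.
  - by rewrite oppr_ge0.
  - by rewrite lerN2.
have half c d : a <= c -> c <= d -> d <= b -> C * (d - c) `^ p <= C * (b - a) `^ p.
  move=> ac cd db; apply: ler_wpM2l => //.
  by apply: ge0_ler_powR; rewrite ?nnegrE ?subr_ge0 ?(ltW p0)//; lra.
have W0 : 0 <= C * (b - a) `^ p by rewrite mulr_ge0 ?powR_ge0.
have [a0|a0] := leP 0 a; first by have := pos a b a0 ab; lra.
have [b0|b0] := leP b 0; first by have := neg a b b0 ab; lra.
rewrite (Rintegral_itv_chasles cg (ltW a0) (ltW b0)).
have := neg a 0 (lexx _) (ltW a0); have := pos 0 b (lexx _) (ltW b0).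
have := half a 0 (lexx _) (ltW a0) (ltW b0).
have := half 0 b (ltW a0) (ltW b0) (lexx _).
lra.
Qed.

(** * The supremum norm *)

Lemma lebesgue_measure_itvN11 {R : realType} :
  (0 < @lebesgue_measure R `[(-1)%R, 1%R])%E.
Proof.
rewrite lebesgue_measure_itv/= lte_fin ifT; last by lra.
by rewrite -EFinB lte_fin; lra.
Qed.

Lemma lebesgue_measureT_gt0 {R : realType} : (0 < @lebesgue_measure R setT)%E.
Proof.
apply: lt_le_trans (@lebesgue_measure_itvN11 R) _.
by apply: le_measure; rewrite ?inE.
Qed.

Lemma Linfty_norm_le {R : realType} (g : R -> R) (c : R) :
  (forall x, `|g x| <= c) -> (Linfty_norm g <= c%:E)%E.
Proof.
move=> gc; rewrite /Linfty_norm unlock lebesgue_measureT_gt0.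
by apply/ess_supP; apply/aeW => x /=; rewrite lee_fin.
Qed.

(** A lower bound on [-1, 1], a set of positive measure, contradicts
    a smaller almost everywhere bound. *)
Lemma Linfty_norm_ge {R : realType} (g : R -> R) (c : R) :
  (forall x, -1 <= x <= 1 -> c <= g x) -> (c%:E <= Linfty_norm g)%E.
Proof.
move=> cg; rewrite /Linfty_norm unlock lebesgue_measureT_gt0 leNgt.
apply/negP => lt_c.
have [N [mN N0 subN]] := ess_sup_ge (@lebesgue_measure R) (abse \o (EFin \o g)).
suff : (@lebesgue_measure R `[(-1)%R, 1%R] <= @lebesgue_measure R N)%E.
  by rewrite N0 leNgt lebesgue_measure_itvN11.
apply: le_measure; rewrite ?inE//.
move=> x /=; rewrite in_itv/= => x1; apply: subN => /= gx.
have := le_lt_trans gx lt_c; rewrite lte_fin ltNge => /negP; apply.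
exact: le_trans (cg x x1) (ler_norm _).
Qed.

(** * Pointwise decay rates of the solution *)

(** The first inequality gives m <= 2 k, which matters for small t, and the second
    gives m^(1 + al) t^al <= 2 C, which matters for large t.  As
    (1 + t)^al <= 1 + t^al, the two add up to a bound for m^(1 + al) (1 + t)^al,
    which is uniform in t. *)
Lemma decay_rate {R : realType} (al k C t m : R) :
  0 < al -> 0 <= k -> 0 <= C -> 0 < t -> 0 <= m ->
  m ^+ 2 * t <= 2 * (k * (m * t)) ->
  m ^+ 2 * t <= 2 * (C * (m * t) `^ (1 - al)) ->
  al <= 1 ->
  m <= ((2 * k) `^ (1 + al) + 2 * C) `^ (1 + al)^-1 / (1 + t) `^ (al / (1 + al)).
Proof.
move=> al0 k0 C0 t0; rewrite le_eqVlt => /predU1P[<- _ _ _|m0 mk mC al1].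
  by rewrite divr_ge0 ?powR_ge0.
have s0 : 0 < 1 + al by rewrite addr_gt0.
have t1 : 0 < 1 + t by rewrite addr_gt0.
have mt0 : 0 < m * t by rewrite mulr_gt0.
have m2k : m <= 2 * k by rewrite -(ler_pM2r mt0) -[leRHS]mulrA [leLHS]mulrA -expr2.
have factorE : m ^+ 2 * t = m `^ (1 + al) * t `^ al * (m * t) `^ (1 - al).
  rewrite powRM ?ltW// mulrACA -!powRD ?(gt_eqF m0) ?(gt_eqF t0) ?implybT//.
  have -> : 1 + al + (1 - al) = 2%:R by ring.
  have -> : al + (1 - al) = 1 by ring.
  by rewrite powR_mulrn ?ltW// powRr1 ?ltW.
have far : m `^ (1 + al) * t `^ al <= 2 * C.
  by rewrite -(ler_pM2r (powR_gt0 (1 - al) mt0)) -factorE -[leRHS]mulrA.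
have near : m `^ (1 + al) <= (2 * k) `^ (1 + al).
  by apply: ge0_ler_powR; rewrite ?nnegrE ?(ltW s0) ?(ltW m0) ?mulr_ge0.
have key : (m * (1 + t) `^ (al / (1 + al))) `^ (1 + al)
    <= (2 * k) `^ (1 + al) + 2 * C.
  rewrite powRM ?powR_ge0 ?(ltW m0)// -powRrM divfK ?gt_eqF//.
  apply: (@le_trans _ _ (m `^ (1 + al) * (1 + t `^ al))).
    apply: ler_wpM2l; first exact: powR_ge0.
    have := @powRD_le R al 1 t; rewrite powR1; apply => //; last exact: ltW.
    by rewrite al0.
  by rewrite mulrDr mulr1 lerD.
rewrite ler_pdivlMr ?powR_gt0//.
have X0 : 0 <= m * (1 + t) `^ (al / (1 + al)) by rewrite mulr_ge0 ?powR_ge0 ?ltW.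
rewrite -[leLHS](powRr1 X0) -[X in _ `^ X <= _](mulfV (lt0r_neq0 s0)).
rewrite (powRrM _ (1 + al)).
by apply: ge0_ler_powR;
  rewrite ?invr_ge0 ?(ltW s0) ?nnegrE ?powR_ge0 ?addr_ge0 ?powR_ge0 ?mulr_ge0.
Qed.

Lemma tame_int0 {R : realType} (k : R) (g : R -> R) : continuous g ->
  (forall y, 0 <= g y <= k) -> tame_potential k (int0 g).
Proof.
move=> cg gk a b ab; have := int0_bounds cg ab (fun y _ => gk y).
by rewrite mul0r.
Qed.

Lemma burgers_solutionE {R : realType} (f0 : R -> R) (x t : R) : 0 < t ->
  burgers_solution f0 x t = cole_velocity (int0 f0) t x.
Proof. by rewrite /burgers_solution => ->. Qed.

Lemma decay_le {R : realType} (al ka y : R) : 0 < al -> 0 <= ka ->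
  ka / (1 + `|y|) `^ al <= ka.
Proof.
move=> al0 ka0; have y1 : 1 <= 1 + `|y| by rewrite lerDl.
have P1 : 1 <= (1 + `|y|) `^ al.
  have := @ge0_ler_powR R al (ltW al0) 1 (1 + `|y|); rewrite powR1.
  by apply; rewrite ?nnegrE ?(le_trans _ y1).
by rewrite ler_pdivrMr ?(lt_le_trans _ P1)// ler_peMr.
Qed.

Lemma burgers_upper {R : realType} (ka2 al : R) (f0 : R -> R) (x t : R) :
  0 < al < 1 -> 0 <= ka2 -> continuous f0 ->
  (forall y, 0 <= f0 y <= ka2 / (1 + `|y|) `^ al) -> 0 < t ->
  burgers_solution f0 x t <=
  ((2 * ka2) `^ (1 + al) + 2 * (2 * (ka2 / (1 - al)))) `^ (1 + al)^-1
    / (1 + t) `^ (al / (1 + al)).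
Proof.
move=> al01 ka0 cf hf t0; have /andP[al0 al1] := al01.
have hk y : 0 <= f0 y <= ka2.
  by have /andP[-> /le_trans] := hf y; apply; exact: decay_le.
have hT := tame_int0 cf hk.
have hfu y : f0 y <= ka2 / (1 + `|y|) `^ al by have /andP[] := hf y.
rewrite burgers_solutionE//.
have m0 := cole_velocity_ge0 x ka0 t0 hT.
have ml y : y - cole_velocity (int0 f0) t x * t <= y.
  by rewrite gerBl mulr_ge0// ltW.
apply: decay_rate => //.
- by rewrite mulr_ge0// divr_ge0// subr_ge0 ltW.
- apply: (cole_velocity_sqr_le ka0 t0 hT) => y.
  by have /andP[_] := hT _ _ (ml y); rewrite subKr.
- apply: (cole_velocity_sqr_le ka0 t0 hT) => y.
  by have := int0_growth al01 cf ka0 hfu (ml y); rewrite subKr.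
- exact: ltW.
Qed.

(** The a priori bound M is what keeps t f(x, t), hence the spread of the density, of
    order rho = (1 + t)^(1 / (1 + al)); note that
    rho^al = (1 + t)^(al / (1 + al)). *)
Lemma burgers_lower {R : realType} (ka1 ka2 al M : R) (f0 : R -> R) (x t : R) :
  0 < al < 1 -> 0 < ka1 -> 0 <= ka2 -> 0 <= M -> continuous f0 ->
  (forall y, ka1 / (1 + `|y|) `^ al <= f0 y <= ka2) -> 0 < t -> `|x| <= 1 ->
  burgers_solution f0 x t <= M / (1 + t) `^ (al / (1 + al)) ->
  ka1 / (4 * (2 + 2 * (1 + M + 2 * expR 1)) `^ al) / (1 + t) `^ (al / (1 + al))
  <= burgers_solution f0 x t.
Proof.
move=> /andP[al0 al1] ka10 ka20 M0 cf hf t0 x1.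
rewrite burgers_solutionE//; set m := cole_velocity _ _ _ => mM.
have s0 : 0 < 1 + al by rewrite addr_gt0.
have t1 : 1 <= 1 + t by rewrite lerDl ltW.
have t1gt : 0 < 1 + t by rewrite addr_gt0.
have e0 : 0 < expR 1 :> R := expR_gt0 1.
set A := 1 + M + 2 * expR 1.
have A0 : 0 < A by rewrite /A; lra.
pose rho := (1 + t) `^ (1 + al)^-1.
have rhoal : rho `^ al = (1 + t) `^ (al / (1 + al)).
  by rewrite -powRrM mulrC.
have rho1 : 1 <= rho.
  have := @ge0_ler_powR R (1 + al)^-1 _ 1 (1 + t); rewrite powR1.
  by apply; rewrite ?nnegrE ?invr_ge0 ?(ltW s0) ?(ltW t1gt).
have hk y : 0 <= f0 y <= ka2.
  have /andP[lo ->] := hf y; rewrite andbT (le_trans _ lo)//.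
  by rewrite divr_ge0 ?powR_ge0// ltW.
have hT := tame_int0 cf hk.
have tm : t * m <= M * rho.
  have := ler_wpM2l (ltW t0) mM; move/le_trans; apply.
  rewrite mulrCA ler_wpM2l// ler_pdivrMr ?powR_gt0// /rho -powRD; last first.
    by rewrite (gt_eqF t1gt) implybT.
  have -> : (1 + al)^-1 + al / (1 + al) = 1 by field; rewrite gt_eqF.
  by rewrite powRr1 ?(ltW t1gt)// lerDr.
have sq : Num.sqrt t <= rho.
  apply: (@le_trans _ _ ((1 + t) `^ 2^-1)).
    by rewrite powR12_sqrt ?(ltW t1gt)// ler_wsqrtr// lerDr.
  by apply: ler_powR => //; rewrite lef_pV2 ?posrE//; lra.
have spread : `|x| + t * m + 2 * expR 1 * Num.sqrt t <= (2 * A * rho) / 2.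
  have -> : 2 * A * rho / 2 = rho + M * rho + 2 * expR 1 * rho by rewrite /A; field.
  rewrite !lerD ?(le_trans x1)//.
  by rewrite ler_wpM2l// mulr_ge0// ltW.
pose D := (2 + 2 * A) `^ al * rho `^ al.
have D0 : 0 < D by rewrite mulr_gt0 ?powR_gt0//; lra.
pose v := ka1 / (2 * D).
have v0 : 0 < v by rewrite divr_gt0// mulr_gt0.
(* Increments are sought at lengths h <= 1; then all points in sight have
   1 + |z| <= 2 + a <= (2 + 2 A) rho, as rho >= 1. *)
have := cole_velocity_lower ka20 t0 hT (a := 2 * A * rho) (v := v) (h0 := 1)
  _ v0 ltr01 spread.
have -> : v / 2 = ka1 / (4 * (2 + 2 * A) `^ al) / (1 + t) `^ (al / (1 + al)).
  rewrite /v /D rhoal; field; rewrite !gt_eqF// ?powR_gt0//; lra.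
apply; first by rewrite !mulr_gt0// (lt_le_trans _ rho1).
move=> h y /andP[h0 h1] ya.
have yyh : y <= y + h by rewrite lerDl ltW.
have lo z : y <= z <= y + h -> ka1 / D <= f0 z <= ka2.
  move=> /andP[yz zh]; have /andP[lo ->] := hf z; rewrite andbT (le_trans _ lo)//.
  have z1 : 0 < 1 + `|z| by rewrite ltr_pwDl.
  rewrite ler_wpM2l ?(ltW ka10)// lef_pV2 ?posrE ?powR_gt0//.
  rewrite /D -powRM ?(le_trans ler01 rho1)//; last by lra.
  have zle : `|z| <= `|y| + h.
    have -> : z = y + (z - y) by ring.
    apply: (le_trans (ler_normD _ _)); rewrite lerD2l ger0_norm; lra.
  apply: ge0_ler_powR; rewrite ?nnegrE ?(ltW al0) ?addr_ge0//.
    by rewrite mulr_ge0//; lra.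
  have -> : (2 + 2 * A) * rho = 2 * rho + 2 * A * rho by ring.
  by lra.
have /andP[+ _] := int0_bounds cf yyh lo.
have -> : ka1 / D * (y + h - y) = 2 * (h * v) by rewrite /v; field; rewrite gt_eqF.
by [].
Qed.

Theorem theorem1p1 (R : realType) (kappa1 kappa2 alpha : R)
    (hkappa1 : 0 < kappa1) (hkappa2 : 0 < kappa2)
    (halpha : 0 < alpha < 1) :
  exists K1 K2 : R, 0 < K1 /\ 0 < K2 /\
    forall f0 : R -> R, continuous f0 ->
      (forall y : R, kappa1 / (1 + `|y|) `^ alpha <= f0 y
                     /\ f0 y <= kappa2 / (1 + `|y|) `^ alpha) ->
      forall t : R, 0 <= t ->
        ((K1 / (1 + t) `^ (alpha / (1 + alpha)))%:E
           <= Linfty_norm (fun x => burgers_solution f0 x t))%E /\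
        (Linfty_norm (fun x => burgers_solution f0 x t)
           <= (K2 / (1 + t) `^ (alpha / (1 + alpha)))%:E)%E.
Proof.
have /andP[al0 al1] := halpha.
set C := 2 * (kappa2 / (1 - alpha)).
pose M := ((2 * kappa2) `^ (1 + alpha) + 2 * C) `^ (1 + alpha)^-1.
pose Q := 2 + 2 * (1 + M + 2 * expR 1 : R).
have s0 : 0 < 1 + alpha by rewrite addr_gt0.
have k2 : 0 < 2 * kappa2 by rewrite mulr_gt0.
have C0 : 0 < C by rewrite mulr_gt0// divr_gt0// subr_gt0.
have M0 : 0 < M by rewrite powR_gt0// ltr_wpDl ?powR_ge0// mulr_gt0.
have e0 : 0 < expR 1 :> R := expR_gt0 1.
have Q2 : 2 <= Q by rewrite /Q; lra.
(* M must also serve at t = 0, where only f0 <= kappa2 is available. *)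
have kM : kappa2 <= M.
  apply: (@le_trans _ _ (2 * kappa2)); first by lra.
  rewrite /M -[leLHS](powRr1 (ltW k2)) -[X in _ `^ X <= _](mulfV (lt0r_neq0 s0)).
  rewrite (powRrM _ (1 + alpha)); apply: ge0_ler_powR.
  - by rewrite invr_ge0 ltW.
  - by rewrite nnegrE powR_ge0.
  - by rewrite nnegrE addr_ge0 ?powR_ge0// mulr_ge0// ltW.
  - by rewrite lerDl mulr_ge0// ltW.
exists (kappa1 / (4 * Q `^ alpha)), M; split.
  by rewrite divr_gt0// mulr_gt0// powR_gt0; lra.
split=> // f0 cf hf t t0.
have f0_ge0 y : 0 <= f0 y.
  by have [+ _] := hf y; apply: le_trans; rewrite divr_ge0 ?powR_ge0// ltW.
have f0_le y : f0 y <= kappa2.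
  by have [_ /le_trans] := hf y; apply; exact: decay_le (ltW hkappa2).
(* At t = 0 the solution is f0 itself. *)
move: t0; rewrite le_eqVlt => /predU1P[<-|t0].
  rewrite addr0 powR1 !divr1; split.
    apply: Linfty_norm_ge => x x1; rewrite /burgers_solution ltxx.
    have [+ _] := hf x; apply: le_trans.
    have x0 : 0 < 1 + `|x| by rewrite ltr_pwDl.
    have xQ : (1 + `|x|) `^ alpha <= Q `^ alpha.
      apply: ge0_ler_powR; rewrite ?nnegrE ?(ltW al0) ?(ltW x0)//; first by lra.
      by apply: le_trans Q2; have := x1; rewrite -ler_norml; lra.
    have P0 := powR_gt0 alpha x0.
    rewrite ler_wpM2l ?(ltW hkappa1)// lef_pV2 ?posrE//; first by lra.
    by rewrite mulr_gt0// (lt_le_trans P0).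
  apply: Linfty_norm_le => x; rewrite /burgers_solution ltxx ger0_norm//.
  exact: le_trans (f0_le x) kM.
have sol_le x : burgers_solution f0 x t <= M / (1 + t) `^ (alpha / (1 + alpha)).
  apply: burgers_upper => //; first exact: ltW.
  by move=> y; rewrite f0_ge0/=; case: (hf y).
have sol_ge0 x : 0 <= burgers_solution f0 x t.
  have hT := @tame_int0 R kappa2 f0 cf (fun y => ltac:(by rewrite f0_ge0 f0_le)).
  by rewrite burgers_solutionE// (cole_velocity_ge0 x (ltW hkappa2) t0 hT).
split; last by apply: Linfty_norm_le => x; rewrite ger0_norm.
apply: Linfty_norm_ge => x x1; rewrite /Q.
apply: (burgers_lower (ka2 := kappa2)) => //.
- exact: ltW.
- exact: ltW.
- by move=> y; rewrite f0_le andbT; case: (hf y).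
- by rewrite ler_norml.
Qed.
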